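(* Let $A$ be a $\Bbbk$-algebra and set $S=A[t;\sigma]$, where $\sigma\in\operatorname{Aut}(A)$ has finite order $m<\infty$ and no $\sigma^i$ with $1\le i<m$ is inner. Suppose $R$ is a central subalgebra of $S$ and set $B=R\cap A^{\sigma}$. If $A$ is finitely generated free over $B$ of rank $n$ and $R=B[t^m]$, then $S$ is finitely generated free over $R$ and $$d(S/R)=_{R^\times}\bigl(d(A/B)\bigr)^m\,\bigl(t^{m-1}\bigr)^{mn}.$$
   Context: $\Bbbk$ is an algebraically closed field of characteristic zero; all algebras are (unital associative, not necessarily commutative) $\Bbbk$-algebras and automorphisms are $\Bbbk$-algebra automorphisms. $A^\sigma$ is the subalgebra of elements fixed by $\sigma$. The Ore extension $A[t;\sigma]$ is generated by $A$ and $t$ with the rule $ta=\sigma(a)t$ for all $a\in A$ (free as a left $A$-module on the powers of $t$). An automorphism $\sigma$ of $A$ is called inner if there exists a nonzero $a\in A$ such that $xa=a\sigma(x)$ for all $x\in A$. Discriminant: if $P$ is an algebra that is finitely generated free of rank $N$ over a central subalgebra $Q\subseteq C(P)$, left multiplication gives an embedding $P\to\operatorname{End}_Q(P)\cong M_N(Q)$, and $\operatorname{tr}:P\to Q$ is its composition with the matrix trace. For a $Q$-basis $\{z_1,\dots,z_N\}$ of $P$, $d(P/Q)=\det(\operatorname{tr}(z_iz_j))_{i,j}\in Q$; it is well defined up to multiplication by units of $Q$. The notation $x=_{Q^\times}y$ means $x=cy$ for some unit $c\in Q^\times$. *)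

(* Defs.v *)
From HB Require Import structures.
From mathcomp Require Import all_boot all_order all_algebra.
From mathcomp Require Import zify.
From mathcomp Require Import boolp classical_sets.

Set Implicit Arguments.
Unset Strict Implicit.
Unset Printing Implicit Defensive.

Import GRing.Theory.
Local Open Scope ring_scope.

(* The skew polynomial \sum_i p`_i t^i is carried by p : {poly A}; only the
   product differs, being twisted by t a = sigma(a) t. *)
Definition ore (k : fieldType) (A : algType k) (sigma : {lrmorphism A -> A})
  : Type := {poly A}.

Section OreExtension.
Variables (k : fieldType) (A : algType k) (sigma : {lrmorphism A -> A}).

HB.instance Definition _ := GRing.Zmodule.copy (ore sigma) {poly A}.

Implicit Types (p q r : ore sigma) (a b : A) (c : k).

Definition oreC a : ore sigma := a%:P.
Definition oreX : ore sigma := 'X.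

Definition ore_mul p q : ore sigma :=
  \poly_(n < size p + size q)
    \sum_(i < n.+1) p`_i * iter i sigma q`_(n - i).

Definition ore_scale c p : ore sigma := c%:A *: (p : {poly A}).

Let itD i : {morph iter i sigma : a b / a + b}.
Proof. by move=> a b; elim: i => //= i ->; rewrite rmorphD. Qed.

Let itM i : {morph iter i sigma : a b / a * b}.
Proof. by move=> a b; elim: i => //= i ->; rewrite rmorphM. Qed.

Let it0 i : iter i sigma 0 = 0.
Proof. by elim: i => //= i ->; rewrite rmorph0. Qed.

Let it1 i : iter i sigma 1 = 1.
Proof. by elim: i => //= i ->; rewrite rmorph1. Qed.

Let itZ i c a : iter i sigma (c *: a) = c *: iter i sigma a.
Proof. by elim: i => //= i ->; rewrite linearZ. Qed.

Lemma coef_ore_mul p q n :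
  (ore_mul p q)`_n = \sum_(i < n.+1) p`_i * iter i sigma q`_(n - i).
Proof.
rewrite coef_poly; case: ltnP => // le_pq_n; rewrite big1 // => i _.
have [lt_i_p | le_p_i] := ltnP i (size p); last by rewrite nth_default ?mul0r.
have leB (u v w x : nat) : (u + v <= x)%N -> (w < u)%N -> (v <= x - w)%N.
  by lia.
by rewrite [q`__]nth_default ?it0 ?mulr0 //; exact: leB le_pq_n lt_i_p.
Qed.

Lemma coef_ore_scale c p n : (ore_scale c p)`_n = c *: p`_n.
Proof. by rewrite coefZ mulr_algl. Qed.

Fact ore_mulA : associative ore_mul.
Proof.
move=> p q r; apply/polyP=> n; rewrite !coef_ore_mul.
pose F i j := p`_i * iter i sigma q`_j * iter (i + j) sigma r`_(n - (i + j)).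
transitivity (\sum_(i < n.+1) \sum_(m < n.+1 | (i <= m)%N) F i (m - i)%N).
  apply: eq_bigr => i _; rewrite coef_ore_mul.
  rewrite (big_morph _ (itD i) (it0 i)) mulr_sumr.
  rewrite -(big_mkord xpredT (fun j => p`_i *
     iter i sigma (q`_j * iter j sigma r`_(n - i - j)))).
  rewrite -(big_geq_mkord (0 + i)%N n.+1 xpredT (fun m => F i (m - i)%N)).
  rewrite (big_addn 0 n.+1 i xpredT) subSn ?leq_ord //.
  apply: eq_bigr => j _; rewrite /F addnK itM mulrA.
  by rewrite iterD subnDA.
rewrite (exchange_big_dep xpredT) //=; apply: eq_bigr => m _.
rewrite coef_ore_mul mulr_suml.
rewrite (big_ord_widen n.+1 (fun i => p`_i * iter i sigma q`_(m - i) *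
  iter m sigma r`_(n - m))) ?ltn_ord //.
by apply: eq_big => [i|i le_i_m] //; rewrite /F subnKC //.
Qed.

Fact ore_mul1 : left_id (oreC 1) ore_mul.
Proof.
move=> p; apply/polyP=> n; rewrite coef_ore_mul big_ord_recl coefC /= subn0.
by rewrite mul1r big1 ?addr0 // => i _; rewrite coefC mul0r.
Qed.

Fact ore_mulr1 : right_id (oreC 1) ore_mul.
Proof.
move=> p; apply/polyP=> n; rewrite coef_ore_mul big_ord_recr /= subnn.
rewrite coefC eqxx it1 mulr1 big1 ?add0r // => i _.
by rewrite coefC subn_eq0 leqNgt ltn_ord it0 mulr0.
Qed.

Fact ore_mulDl : left_distributive ore_mul +%R.
Proof.
move=> p q r; apply/polyP=> n; rewrite coefD !coef_ore_mul -big_split.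
by apply: eq_bigr => i _; rewrite coefD mulrDl.
Qed.

Fact ore_mulDr : right_distributive ore_mul +%R.
Proof.
move=> p q r; apply/polyP=> n; rewrite coefD !coef_ore_mul -big_split.
by apply: eq_bigr => i _; rewrite coefD itD mulrDr.
Qed.

Fact ore1_neq0 : oreC 1 != 0.
Proof. by rewrite polyC_eq0 oner_neq0. Qed.

HB.instance Definition _ := GRing.Zmodule_isNzRing.Build (ore sigma)
  ore_mulA ore_mul1 ore_mulr1 ore_mulDl ore_mulDr ore1_neq0.

Fact ore_scaleA c d p : ore_scale c (ore_scale d p) = ore_scale (c * d) p.
Proof. by apply/polyP=> n; rewrite !coef_ore_scale scalerA. Qed.

Fact ore_scale1 : left_id 1 ore_scale.
Proof. by move=> p; apply/polyP=> n; rewrite coef_ore_scale scale1r. Qed.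

Fact ore_scaleDr : right_distributive ore_scale +%R.
Proof.
by move=> c p q; apply/polyP=> n; rewrite coefD !coef_ore_scale coefD scalerDr.
Qed.

Fact ore_scaleDl p : {morph ore_scale^~ p : c d / c + d}.
Proof.
by move=> c d; apply/polyP=> n; rewrite coefD !coef_ore_scale scalerDl.
Qed.

HB.instance Definition _ := GRing.Zmodule_isLmodule.Build k (ore sigma)
  ore_scaleA ore_scale1 ore_scaleDr ore_scaleDl.

Fact ore_scaleAl c p q : c *: (p * q) = (c *: p) * q.
Proof.
apply/polyP=> n; rewrite coef_ore_scale !coef_ore_mul scaler_sumr.
by apply: eq_bigr => i _; rewrite coef_ore_scale !scalerAl.
Qed.

HB.instance Definition _ :=
  GRing.Lmodule_isLalgebra.Build k (ore sigma) ore_scaleAl.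

Fact ore_scaleAr c p q : c *: (p * q) = p * (c *: q).
Proof.
apply/polyP=> n; rewrite coef_ore_scale !coef_ore_mul scaler_sumr.
by apply: eq_bigr => i _; rewrite coef_ore_scale itZ scalerAr.
Qed.

HB.instance Definition _ :=
  GRing.Lalgebra_isAlgebra.Build k (ore sigma) ore_scaleAr.

Fact oreC_is_zmod_morphism : zmod_morphism oreC.
Proof. exact: polyCB. Qed.

Fact oreC_is_monoid_morphism : monoid_morphism oreC.
Proof.
split=> // a b; apply/polyP=> n; rewrite coef_ore_mul big_ord_recl !coefC subn0.
rewrite big1 ?addr0 => [|i _]; last by rewrite coefC mul0r.
by case: n => //=; rewrite mulr0.
Qed.

Fact oreC_is_scalable : scalable oreC.
Proof.
move=> c a; apply/polyP=> n; rewrite coef_ore_scale !coefC.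
by case: n => //=; rewrite scaler0.
Qed.

HB.instance Definition _ :=
  GRing.isZmodMorphism.Build A (ore sigma) oreC oreC_is_zmod_morphism.
HB.instance Definition _ :=
  GRing.isMonoidMorphism.Build A (ore sigma) oreC oreC_is_monoid_morphism.
HB.instance Definition _ :=
  GRing.isScalable.Build k A (ore sigma) *:%R oreC oreC_is_scalable.

Lemma oreC_inj : injective oreC.
Proof. exact: polyC_inj. Qed.

Fact ore_mulX p : p * oreX = (p : {poly A}) * 'X.
Proof.
apply/polyP=> n; rewrite coef_ore_mul coefMX.
case: n => [|n]; first by rewrite big_ord1 coefX it0 mulr0.
rewrite !big_ord_recr /= subnn subSnn !coefX /= it0 it1 rmorph0 mulr0 mulr1 addr0.
rewrite big1 ?add0r // => i _; rewrite coefX.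
have ->: (n.+1 - i == 1)%N = false by have := ltn_ord i; lia.
by rewrite it0 mulr0.
Qed.

Lemma oreX_comm a : oreX * oreC a = oreC (sigma a) * oreX.
Proof.
rewrite ore_mulX; apply/polyP=> n; rewrite coef_ore_mul coefCM coefX.
rewrite big_ord_recr /= big1 => [|i _]; last first.
  by rewrite coefC subn_eq0 leqNgt ltn_ord it0 mulr0.
rewrite add0r subnn coefX coefC eqxx.
by case: n => [|[|n]] /=; rewrite ?(mul0r, mulr0, mul1r, mulr1).
Qed.

Lemma oreCXnE a n : oreC a * oreX ^+ n = a%:P * 'X^n :> {poly A}.
Proof.
elim: n => [|n IHn]; first by rewrite !expr0 !mulr1.
by rewrite !exprSr mulrA ore_mulX IHn mulrA.
Qed.

(* Together with oreCXnE, this says that the powers of t form a basis of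
   ore sigma as a left A-module. *)
Lemma ore_expand p : p = \sum_(i < size p) oreC p`_i * oreX ^+ i.
Proof.
rewrite -[LHS]coefK poly_def; apply: eq_bigr => i _.
by rewrite oreCXnE mul_polyC.
Qed.

End OreExtension.

Record centralSubalg (k : fieldType) (P : algType k) := CentralSubalg {
  csub_pred :> subalgClosed P;
  csub_central : {in csub_pred, forall x y, x * y = y * x}
}.

Section CentralSubalgebra.
Variables (k : fieldType) (P : algType k) (Q : centralSubalg P).

Record csub_of := CSubOf {csub_val :> P; _ : csub_val \in (Q : {pred P})}.

HB.instance Definition _ := [isSub for csub_val].
HB.instance Definition _ := [Choice of csub_of by <:].
HB.instance Definition _ := [SubChoice_isSubAlgebra of csub_of by <:].

Fact csub_mulC : commutative (@GRing.mul csub_of).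
Proof. by move=> x y; apply/val_inj; rewrite !rmorphM; exact: csub_central (valP x) _. Qed.

HB.instance Definition _ :=
  GRing.PzRing_hasCommutativeMul.Build csub_of csub_mulC.

Implicit Types (x y : P).

(* x =_{Q^*} y: the factor must be invertible inside Q, not merely in P. *)
Definition eq_up_to_unit x y :=
  exists c d : csub_of, c * d = 1 /\ x = csub_val c * y.

Section Basis.
Variables (N : nat) (z : 'I_N -> P).

Definition is_basis :=
  forall x, exists! c : 'rV[csub_of]_N, x = \sum_i csub_val (c 0 i) * z i.

(* Uniquely determined when z is a basis; the default 0 is then not used. *)
Definition coords x : 'rV[csub_of]_N :=
  xget 0 [set c : 'rV_N | x = \sum_i csub_val (c 0 i) * z i]%classic.

(* Column j holds the coordinates of x * z j: this is left multiplication
   by x, acting on column vectors. *)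
Definition lmul_mx x : 'M[csub_of]_N :=
  \matrix_(i, j) coords (x * z j) 0 i.

Definition tr x : csub_of := \tr (lmul_mx x).

Definition disc : csub_of := \det (\matrix_(i, j) tr (z i * z j)).

End Basis.

Definition free_of_rank N := exists z : 'I_N -> P, is_basis z.

Definition finite_free := exists N, free_of_rank N.

End CentralSubalgebra.

Definition has_order (T : Type) (f : T -> T) (m : nat) :=
  [/\ (0 < m)%N, iter m f =1 id
    & forall i, (0 < i < m)%N -> ~ (iter i f =1 id)].

(* This only asks a != 0: a need not be invertible. *)
Definition inner (A : nzRingType) (f : A -> A) :=
  exists2 a, a != 0 & forall x, x * a = a * f x.

Section Base.
Variables (k : fieldType) (A : algType k) (sigma : {lrmorphism A -> A}).
Variable R : centralSubalg (ore sigma).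

(* R \cap A^sigma, pulled back along the embedding oreC of A in ore sigma. *)
Definition fixed_base_pred : {pred A} :=
  fun a => (sigma a == a) && (oreC sigma a \in (R : {pred ore sigma})).

Lemma fixed_baseE a : (a \in fixed_base_pred) =
  (sigma a == a) && (oreC sigma a \in (R : {pred ore sigma})).
Proof. by []. Qed.

Fact fixed_base_subalg : GRing.subsemialg_closed fixed_base_pred.
Proof.
split.
- by rewrite fixed_baseE !rmorph1 eqxx rpred1.
- split=> [|a b]; first by rewrite fixed_baseE !rmorph0 eqxx rpred0.
  rewrite !fixed_baseE => /andP[/eqP sa Ra] /andP[/eqP sb Rb].
  by rewrite !rmorphD /= sa sb eqxx rpredD.
- move=> c a; rewrite !fixed_baseE => /andP[/eqP sa Ra].
  by rewrite !linearZ /= sa eqxx rpredZ.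
move=> a b; rewrite !fixed_baseE => /andP[/eqP sa Ra] /andP[/eqP sb Rb].
by rewrite !rmorphM /= sa sb eqxx rpredM.
Qed.

HB.instance Definition _ :=
  GRing.isSubalgClosed.Build k A fixed_base_pred fixed_base_subalg.

Fact fixed_base_central : {in fixed_base_pred, forall a b, a * b = b * a}.
Proof.
move=> a /andP[_ Ra] b; apply: (@oreC_inj _ _ sigma).
by rewrite !rmorphM; exact: csub_central Ra _.
Qed.

Definition fixed_base : centralSubalg A := CentralSubalg fixed_base_central.

End Base.

(* x lies in B[s], the set of values at s of polynomials over B. *)
Definition in_adjoin (k : fieldType) (A : algType k)
    (sigma : {lrmorphism A -> A}) (B : centralSubalg A) (s x : ore sigma) :=
  exists2 p : {poly A}, p \is a polyOver (B : {pred A})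
    & x = \sum_(i < size p) oreC sigma p`_i * s ^+ i.

(* Main.v *)
(** If [z] is a B-basis of A, then the elements [z_i t^j], [j < m], form an
    R-basis of S, since R = B[t^m].  With respect to it, left multiplication by
    [a t^f] permutes the blocks [A t^j R] cyclically by [f], so its trace is
    [0] unless [m] divides [f], while [tr_S a = m tr_A a].  Since [sigma] is a
    B-linear automorphism of A, the elements [t^j z_i] form an R-basis as well.
    The Gram matrix of [z_i t^j] against [t^((-l) mod m) z_h] is block diagonal,
    with blocks [m G] for [j = 0] and [m t^m G] for the [m - 1] other values of
    [j], where [G] is the Gram matrix of [z].  Its determinant is [m^(mn)]
    times the claimed value, and it differs from the discriminant by the
    determinants of two changes of basis, which are units. *)

From HB Require Import structures.
From mathcomp Require Import all_boot all_order all_algebra.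
From mathcomp Require Import classical_sets.
Require Import Defs.

Set Implicit Arguments.
Unset Strict Implicit.
Unset Printing Implicit Defensive.

Import GRing.Theory.
Local Open Scope ring_scope.

(** * Determinants of block diagonal matrices *)

Lemma det_castmx (R : comPzRingType) (n n' : nat) (e : n = n') (M : 'M[R]_n) :
  \det (castmx (e, e) M) = \det M.
Proof. by case: n' / e; rewrite castmx_id. Qed.

Lemma det_mxdiag (R : comPzRingType) (m : nat) (p_ : 'I_m -> nat)
    (D : forall i, 'M[R]_(p_ i)) :
  \det (mxdiag D) = \prod_i \det (D i).
Proof.
elim: m p_ D => [|m IHm] p_ D.
  by rewrite [RHS]big_ord0; move: (mxdiag D); rewrite big_ord0; exact: det_mx00.
by rewrite mxdiag_recl det_castmx det_ublock IHm big_ord_recl.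
Qed.

(** * Bases over a central subalgebra: coordinates, traces, transition matrices *)

Section Bases.
Variables (k : fieldType) (P : algType k) (Q : centralSubalg P).
Implicit Types (x y : P) (q : csub_of Q).
Local Notation val := (@csub_val k P Q).

HB.instance Definition _ := GRing.isZmodMorphism.Build (csub_of Q) P
  (@csub_val k P Q) (@raddfB _ _ (\val : csub_of Q -> P)).
HB.instance Definition _ := GRing.isMonoidMorphism.Build (csub_of Q) P
  (@csub_val k P Q) (rmorphism_monoidP (\val : csub_of Q -> P)).

Lemma csub_valC q x : val q * x = x * val q.
Proof. exact: csub_central (valP q) x. Qed.

Lemma basisP N (z : 'I_N -> P) :
  (forall x, exists c : 'rV[csub_of Q]_N, x = \sum_i val (c 0 i) * z i) ->
  (forall c : 'rV[csub_of Q]_N,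
     \sum_i val (c 0 i) * z i = 0 -> c = 0) ->
  is_basis Q z.
Proof.
move=> gen free x; have [c xE] := gen x; exists c; split=> // d xE'.
apply/eqP; rewrite -subr_eq0; apply/eqP/free.
under eq_bigr do rewrite !mxE rmorphB mulrBl.
by rewrite sumrB -xE -xE' subrr.
Qed.

Section Coordinates.
Variables (N : nat) (z : 'I_N -> P) (zP : is_basis Q z).

Lemma coords_sum x : x = \sum_i val (coords Q z x 0 i) * z i.
Proof.
rewrite /coords; case: xgetP => [c -> //|].
by have [c [cx _]] := zP x => /(_ c).
Qed.

Lemma coords_uniq x (c : 'rV[csub_of Q]_N) :
  x = \sum_i val (c 0 i) * z i -> coords Q z x = c.
Proof.
move=> xE; have [d [_ dP]] := zP x.
by rewrite -(dP _ (coords_sum x)) (dP _ xE).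
Qed.

Lemma coordsD x y : coords Q z (x + y) = coords Q z x + coords Q z y.
Proof.
apply: coords_uniq; rewrite {1}(coords_sum x) {1}(coords_sum y) -big_split.
by apply: eq_bigr => i _; rewrite mxE rmorphD mulrDl.
Qed.

Lemma coords0 : coords Q z 0 = 0.
Proof. by apply: coords_uniq; rewrite big1 // => i _; rewrite mxE rmorph0 mul0r. Qed.

Lemma coordsZ q x : coords Q z (val q * x) = q *: coords Q z x.
Proof.
apply: coords_uniq; rewrite {1}(coords_sum x) mulr_sumr.
by apply: eq_bigr => i _; rewrite mxE rmorphM mulrA.
Qed.

Lemma coords_comb M (v : 'I_M -> P) (c : 'I_M -> csub_of Q) :
  coords Q z (\sum_j val (c j) * v j) = \sum_j c j *: coords Q z (v j).
Proof.
rewrite (big_morph _ coordsD coords0).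
by apply: eq_bigr => j _; rewrite coordsZ.
Qed.

Lemma trD x y : tr Q z (x + y) = tr Q z x + tr Q z y.
Proof.
rewrite /tr -linearD; congr (\tr _); apply/matrixP=> i j.
by rewrite !mxE mulrDl coordsD mxE.
Qed.

Lemma tr0 : tr Q z 0 = 0.
Proof.
by rewrite /tr /mxtrace big1 // => i _; rewrite mxE mul0r coords0 mxE.
Qed.

Lemma trZ q x : tr Q z (val q * x) = q * tr Q z x.
Proof.
rewrite /tr -mxtraceZ; congr (\tr _); apply/matrixP=> i j.
by rewrite !mxE -mulrA coordsZ mxE.
Qed.

End Coordinates.

Definition coords_mx N M (z : 'I_N -> P) (v : 'I_M -> P) : 'M[csub_of Q]_(N, M) :=
  \matrix_(i, j) coords Q z (v j) 0 i.

(** Expand [v j] in the basis [w]: the coefficients are central, so they pass to the left of [x],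
    where coordinates in [z] are Q-linear. *)
Lemma coords_mx_mul N N' M x (z : 'I_N -> P) (w : 'I_N' -> P) (v : 'I_M -> P) :
  is_basis Q z -> is_basis Q w ->
  coords_mx z (fun j => x * v j) =
  coords_mx z (fun j => x * w j) *m coords_mx w v.
Proof.
move=> zP wP; apply/matrixP=> i j; rewrite !mxE.
rewrite {1}(coords_sum wP (v j)) mulr_sumr.
under eq_bigr do rewrite mulrA -csub_valC -mulrA.
rewrite coords_comb // summxE; apply: eq_bigr => l _.
by rewrite !mxE mulrC.
Qed.

Lemma coords_mx_comp N N' M (z : 'I_N -> P) (w : 'I_N' -> P) (v : 'I_M -> P) :
  is_basis Q z -> is_basis Q w ->
  coords_mx z v = coords_mx z w *m coords_mx w v.
Proof.
move=> zP wP; have := coords_mx_mul 1 v zP wP.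
have mul1v L (u : 'I_L -> P) : coords_mx z (fun j => 1 * u j) = coords_mx z u.
  by apply/matrixP=> i j; rewrite !mxE mul1r.
by rewrite !mul1v.
Qed.

Lemma coords_mx_id N (z : 'I_N -> P) : is_basis Q z -> coords_mx z z = 1%:M.
Proof.
move=> zP; apply/matrixP=> i j; rewrite !mxE.
rewrite (coords_uniq zP (c := delta_mx 0 j)) ?mxE //.
rewrite (bigD1 j) //= !mxE !eqxx rmorph1 mul1r big1 ?addr0 // => l lj.
by rewrite !mxE (negPf lj) rmorph0 mul0r.
Qed.

Lemma coords_mxK N M (z : 'I_N -> P) (w : 'I_M -> P) :
  is_basis Q z -> is_basis Q w -> coords_mx z w *m coords_mx w z = 1%:M.
Proof. by move=> zP wP; rewrite -coords_mx_comp ?coords_mx_id. Qed.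

(** The matrix of [x] in [z] factors as (coordinates in [z] of [x * w]) times (coordinates in [w] of
    [z]). Swapping the factors under the trace leaves the matrix of [x] in [w]. *)
Lemma tr_basis_indep N M (z : 'I_N -> P) (w : 'I_M -> P) x :
  is_basis Q z -> is_basis Q w -> tr Q z x = tr Q w x.
Proof.
move=> zP wP; rewrite /tr.
have -> : lmul_mx Q z x = coords_mx z (fun j => x * z j) by [].
rewrite (coords_mx_mul x z zP wP) mxtrace_mulC.
by rewrite -(coords_mx_comp _ wP zP).
Qed.

(** The two products of the transition matrices are identities of sizes [N] and [M] with the same
    trace, so [N = M] holds in [P], and characteristic zero brings this back to natural numbers. *)
Lemma basis_size N M (z : 'I_N -> P) (w : 'I_M -> P) :
  [pchar k] =i pred0 -> is_basis Q z -> is_basis Q w -> N = M.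
Proof.
move=> chk zP wP.
have /(congr1 (fun q => val q)) : (N%:R : csub_of Q) = M%:R.
  rewrite -!mxtrace1 -(coords_mxK zP wP) -(coords_mxK wP zP).
  exact: mxtrace_mulC.
rewrite !rmorph_nat => /eqP eqNM.
have char_inj (i j : nat) : (i%:R : P) == j%:R -> (i <= j)%N.
  rewrite leqNgt => eqij; apply/negP=> lt_ji.
  have := eqij; rewrite -subr_eq0 -natrB ?(ltnW lt_ji) //.
  rewrite -scaler_nat scaler_eq0 oner_eq0 orbF.
  have /pcharf0P -> := chk; by rewrite subn_eq0 leqNgt lt_ji.
by apply/eqP; rewrite eqn_leq !char_inj // eq_sym.
Qed.

Definition gram_mx N M (tau : P -> csub_of Q) (u : 'I_N -> P) (v : 'I_M -> P) :=
  \matrix_(i, j) tau (u i * v j).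

Lemma gram_mx_change L N M N' M' (b : 'I_L -> P) (u : 'I_N -> P) (v : 'I_M -> P)
    (u' : 'I_N' -> P) (v' : 'I_M' -> P) :
  is_basis Q b -> is_basis Q u -> is_basis Q v ->
  gram_mx (tr Q b) u' v' =
  (coords_mx u u')^T *m gram_mx (tr Q b) u v *m coords_mx v v'.
Proof.
move=> bP uP vP; apply/matrixP=> i j.
rewrite !mxE {1}(coords_sum uP (u' i)) {1}(coords_sum vP (v' j)) mulr_sumr.
rewrite (big_morph _ (trD bP) (tr0 bP)); apply: eq_bigr => l _.
rewrite mulrA -csub_valC -!mulrA trZ // !mxE mulrC; congr (_ * _).
rewrite mulr_suml (big_morph _ (trD bP) (tr0 bP)); apply: eq_bigr => h _.
by rewrite -mulrA trZ // !mxE.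
Qed.

(* Two different bases may be used on the two sides of the Gram matrix; this
   is what removes the twist by [sigma] in the theorem. *)
Lemma disc_gram N (w u v : 'I_N -> P) :
  is_basis Q w -> is_basis Q u -> is_basis Q v ->
  exists c d : csub_of Q, c * d = 1 /\
    disc Q w = c * \det (gram_mx (tr Q u) u v).
Proof.
move=> wP uP vP.
exists (\det (coords_mx u w) * \det (coords_mx v w)).
exists (\det (coords_mx w u) * \det (coords_mx w v)); split.
  by rewrite mulrACA -2!det_mulmx !coords_mxK // det1 mulr1.
have -> : disc Q w = \det (gram_mx (tr Q u) w w).
  congr (\det _); apply/matrixP=> i j; rewrite !mxE.
  exact: tr_basis_indep wP uP.
by rewrite (gram_mx_change w w uP uP vP) !det_mulmx det_tr mulrAC.
Qed.

End Bases.

(** * Coefficients and commutation rules in the Ore extension *)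

Section OreCoefficients.
Variables (k : fieldType) (A : algType k) (sigma : {lrmorphism A -> A}).
Implicit Types (p : ore sigma) (a : A).
Local Notation t := (oreX sigma).

Lemma ore_mulXn p n : p * t ^+ n = (p : {poly A}) * 'X^n.
Proof.
elim: n => [|n IHn]; first by rewrite !expr0 !mulr1.
by rewrite !exprSr mulrA ore_mulX IHn mulrA.
Qed.

Lemma coef_ore_mulXn p n i :
  (p * t ^+ n)`_i = if (i < n)%N then 0 else p`_(i - n).
Proof. by rewrite ore_mulXn coefMXn. Qed.

Lemma coef_ore_mulC p a i : (p * oreC sigma a)`_i = p`_i * iter i sigma a.
Proof.
have iter0 j : iter j sigma 0 = 0 by elim: j => //= j ->; rewrite rmorph0.
rewrite coef_ore_mul big_ord_recr /= subnn coefC eqxx big1 ?add0r // => j _.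
by rewrite coefC subn_eq0 leqNgt ltn_ord iter0 mulr0.
Qed.

Lemma oreXn_comm n a : t ^+ n * oreC sigma a = oreC sigma (iter n sigma a) * t ^+ n.
Proof.
elim: n a => [|n IHn] a; first by rewrite mul1r mulr1.
by rewrite exprSr -mulrA oreX_comm mulrA IHn -mulrA -exprSr iterSr.
Qed.

End OreCoefficients.

(** The R-bases of S are indexed by this ordinal, rather than by pairs, to match the block indexing
    of [mxdiag]. *)
Lemma sum_tagnat (V : nmodType) (m n : nat) (F : 'I_m -> 'I_n -> V) :
  \sum_(s : 'I_(\sum_(j < m) n)) F (tagnat.sig1 s) (tagnat.sig2 s) =
  \sum_j \sum_i F j i.
Proof.
rewrite sig_big_dep /=.
by rewrite [RHS](reindex _ (@tagnat.sig_bij_on m (fun=> n))); apply: eq_bigr.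
Qed.

(** * The Ore extension as a module over R = B[t^m] *)

Section FreeOreExtension.
Variables (k : fieldType) (A : algType k) (sigma : {lrmorphism A -> A}).
Variables (m n : nat) (R : centralSubalg (ore sigma)).
Local Notation t := (oreX sigma).
Local Notation B := (fixed_base R).
Hypothesis m_gt0 : (0 < m)%N.
Hypothesis sigma_bij : bijective sigma.
Hypothesis sigmam : iter m sigma =1 id.
Hypothesis RE :
  forall x : ore sigma, x \in (R : {pred ore sigma}) <-> in_adjoin B (t ^+ m) x.

Implicit Types (a : A) (b : csub_of B) (r : csub_of R).

Lemma base_in_center b : oreC sigma (csub_val b) \in (R : {pred ore sigma}).
Proof. by case: b => b /= /andP[]. Qed.

Definition base_inj b : csub_of R := CSubOf (base_in_center b).

Fact base_inj_is_zmod_morphism : zmod_morphism base_inj.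
Proof. by move=> b c; apply/val_inj; rewrite /= !rmorphB. Qed.

Fact base_inj_is_monoid_morphism : monoid_morphism base_inj.
Proof.
by split=> [|b c]; apply/val_inj; rewrite /= ?rmorph1 // !rmorphM.
Qed.

HB.instance Definition _ := GRing.isZmodMorphism.Build (csub_of B) (csub_of R)
  base_inj base_inj_is_zmod_morphism.
HB.instance Definition _ := GRing.isMonoidMorphism.Build (csub_of B) (csub_of R)
  base_inj base_inj_is_monoid_morphism.

Lemma oreXm_in_center : t ^+ m \in (R : {pred ore sigma}).
Proof.
apply/RE; exists 'X; first by rewrite polyOverX.
rewrite size_polyX 2!big_ord_recr big_ord0 /= !coefX /= rmorph0 rmorph1.
by rewrite mul0r mul1r !add0r.
Qed.

Definition center_Xm : csub_of R := CSubOf oreXm_in_center.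

Lemma center_coef r i :
  [/\ (csub_val r)`_i \in (B : {pred A})
    & ~~ (m %| i)%N -> (csub_val r)`_i = 0].
Proof.
have /RE[p pB ->] := valP r.
rewrite coef_sum; split.
  apply: rpred_sum => j _; rewrite -exprM oreCXnE coefCM coefXn.
  by case: eqP => _; rewrite ?mulr1 ?mulr0 ?rpred0 // (polyOverP pB).
move=> mNi; rewrite big1 // => j _; rewrite -exprM oreCXnE coefCM coefXn.
case: eqP => [iE|]; last by rewrite mulr0.
by rewrite iE dvdn_mulr in mNi.
Qed.

Lemma iter_sigma_dvd i a : (m %| i)%N -> iter i sigma a = a.
Proof.
case/dvdnP=> q ->; elim: q => [|q IHq] //.
by rewrite mulSn iterD IHq sigmam.
Qed.

(** The coefficient of [r] in degree [i - j] vanishes unless [m] divides [i - j], and then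
    sigma^(i-j) is the identity, so no twist of [a] survives. *)
Lemma coef_center_mul r a j i : (j < m)%N ->
  (csub_val r * (oreC sigma a * t ^+ j))`_i =
  if (i %% m == j)%N then (csub_val r)`_(i - j) * a else 0.
Proof.
move=> lt_jm; rewrite mulrA coef_ore_mulXn coef_ore_mulC.
have [_ r0] := center_coef r (i - j).
case: ltnP => [lt_ij|le_ji].
  by rewrite modn_small ?(ltn_trans lt_ij) // ltn_eqF.
have -> : (i %% m == j)%N = (m %| i - j)%N.
  by rewrite -eqn_mod_dvd // (modn_small lt_jm).
case: (boolP (m %| i - j)%N) => [/iter_sigma_dvd-> //|/r0->].
by rewrite mul0r.
Qed.

(** Since sigma fixes B pointwise, it is B-linear; surjectivity gives generation and injectivity
    gives independence. *)
Lemma sigma_basis N (z : 'I_N -> A) :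
  is_basis B z -> is_basis B (fun i => sigma (z i)).
Proof.
move=> zP; have [tau sigmaK tauK] := sigma_bij.
have sigmaE (c : 'rV[csub_of B]_N) :
    \sum_i csub_val (c 0 i) * sigma (z i) = sigma (\sum_i csub_val (c 0 i) * z i).
  rewrite rmorph_sum; apply: eq_bigr => i _; rewrite rmorphM.
  by case: (c 0 i) => b /= /andP[/eqP-> _].
apply: basisP => [x|c].
  exists (coords B z (tau x)).
  by rewrite sigmaE -(coords_sum zP) tauK.
rewrite sigmaE => sc0; rewrite -(coords_uniq zP (c := c) (x := 0)) ?coords0 //.
by apply: (can_inj sigmaK); rewrite sc0 rmorph0.
Qed.

Lemma iter_sigma_basis N (z : 'I_N -> A) j :
  is_basis B z -> is_basis B (fun i => iter j sigma (z i)).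
Proof. by move=> zP; elim: j => //= j; exact: sigma_basis. Qed.

(** A constant [z] with [e = id] gives the z_i t^j. Letting the basis vary with [j] and permuting
    the exponents also covers the t^j z_i, whose coefficients are sigma^j(z_i). *)
Definition ore_family (z : 'I_m -> 'I_n -> A) (e : 'I_m -> 'I_m)
    (s : 'I_(\sum_(j < m) n)) : ore sigma :=
  oreC sigma (z (tagnat.sig1 s) (tagnat.sig2 s)) * t ^+ e (tagnat.sig1 s).

Section OreBasis.
Variables (z : 'I_m -> 'I_n -> A) (e : 'I_m -> 'I_m).
Hypotheses (zP : forall j, is_basis B (z j)) (e_inj : injective e).

(** Divide [g] by [m]: the quotient gives a central power of t^m, and the remainder selects the one
    block in which [a] is expanded over B. *)
Lemma ore_monomial_comb a g :
  oreC sigma a * t ^+ g = \sum_s csub_val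
    (if (e (tagnat.sig1 s) == g %% m :> nat)%N
     then center_Xm ^+ (g %/ m) *
       base_inj (coords B (z (tagnat.sig1 s)) a 0 (tagnat.sig2 s))
     else 0) * ore_family z e s.
Proof.
rewrite (sum_tagnat (fun j i => csub_val
  (if (e j == g %% m :> nat)%N
   then center_Xm ^+ (g %/ m) * base_inj (coords B (z j) a 0 i) else 0) *
  (oreC sigma (z j i) * t ^+ e j))).
have lt_gm : (g %% m < m)%N by rewrite ltn_mod.
(* An injective [e] on a finite type is bijective, so exactly one block has exponent g mod m. *)
pose j0 := invF e_inj (Ordinal lt_gm).
have ej0 : (e j0 = g %% m :> nat)%N by rewrite /j0 f_invF.
rewrite (bigD1 j0) //= [X in _ + X]big1 ?addr0 => [|j]; last first.
  move=> jj0; rewrite big1 // => i _; rewrite -ej0 val_eqE (inj_eq e_inj).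
  by rewrite (negPf jj0) rmorph0 mul0r.
rewrite ej0 eqxx {1}(coords_sum (zP j0) a) rmorph_sum mulr_suml.
apply: eq_bigr => i _.
rewrite !rmorphM /= (csub_valC (center_Xm ^+ _)) -!mulrA csub_valC -!mulrA.
congr (_ * (_ * _)).
by rewrite rmorphXn /= -exprM -exprD addnC mulnC -divn_eq.
Qed.

Lemma ore_family_basis : is_basis R (ore_family z e).
Proof.
apply: basisP => [x|c c0].
  rewrite (ore_expand x).
  apply: (big_ind (fun y => exists c : 'rV[csub_of R]_(\sum_(j < m) n),
    y = \sum_s csub_val (c 0 s) * ore_family z e s)) => [|_ _ [c ->] [d ->]|i _].
  - by exists 0; rewrite big1 // => s _; rewrite mxE rmorph0 mul0r.
  - exists (c + d); rewrite -big_split.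
    by apply: eq_bigr => s _; rewrite mxE rmorphD mulrDl.
  rewrite ore_monomial_comb.
  exists (\row_s (if (e (tagnat.sig1 s) == i %% m :> nat)%N
     then center_Xm ^+ (i %/ m) *
       base_inj (coords B (z (tagnat.sig1 s)) x`_i 0 (tagnat.sig2 s))
     else 0)).
  by apply: eq_bigr => s _; rewrite mxE.
pose d (j : 'I_m) (i : 'I_n) := c 0 (@tagnat.Rank m (fun=> n) j i).
have cE s : c 0 s = d (tagnat.sig1 s) (tagnat.sig2 s).
  by rewrite /d tagnat.sig2K.
have d0 j i : d j i = 0.
  apply/val_inj/polyP=> f; rewrite coef0.
  have [_] := center_coef (d j i) f.
  case: (boolP (m %| f)%N) => [/dvdnP[l fE] _|_ -> //].
  have dB i' : (csub_val (d j i'))`_f \in (B : {pred A}).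
    by have [] := center_coef (d j i') f.
  (* Degree [f + e j] isolates block [j], the exponents of the other blocks being different mod [m].
     What remains is a B-linear relation among the [z j i]. *)
  have := congr1 (fun p : ore sigma => p`_(f + e j)) c0.
  rewrite coef0 coef_sum.
  under eq_bigr do rewrite cE coef_center_mul ?ltn_ord //.
  rewrite (sum_tagnat (fun j' i' => if ((f + e j) %% m == e j')%N
    then (csub_val (d j' i'))`_(f + e j - e j') * z j' i' else 0)).
  have fjE : ((f + e j) %% m = e j)%N by rewrite fE modnMDl modn_small.
  rewrite (bigD1 j) //= [X in _ + X]big1 ?addr0 => [|j' j'j]; last first.
    rewrite big1 // => i' _.
    by rewrite fjE val_eqE (inj_eq e_inj) eq_sym (negPf j'j).
  under eq_bigr => i' _ do rewrite fjE eqxx addnK.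
  move=> sum0.
  have := coords_uniq (zP j) (x := 0) (c := \row_i' CSubOf (dB i')).
  rewrite coords0 // => /(_ _)/rowP/(_ i); rewrite !mxE.
  move=> /(_ _)/(congr1 (@csub_val _ _ _)) /= <- //.
  by rewrite -[LHS]sum0; apply: eq_bigr => i' _; rewrite mxE.
by apply/rowP=> s; rewrite cE d0 mxE.
Qed.
End OreBasis.

(** * Traces of monomials and the Gram determinant *)

Section Trace.
Variables (z : 'I_n -> A) (zP : is_basis B z).
Local Notation u := (ore_family (fun=> z) id).
Local Notation trS := (tr R u).

Let uP : is_basis R u.
Proof. exact: ore_family_basis (fun=> zP) (@inj_id _). Qed.

Lemma coords_ore_monomial a g s :
  coords R u (oreC sigma a * t ^+ g) 0 s =
  if (tagnat.sig1 s == g %% m :> nat)%N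
  then center_Xm ^+ (g %/ m) * base_inj (coords B z a 0 (tagnat.sig2 s)) else 0.
Proof.
pose c : 'rV[csub_of R]_(\sum_(j < m) n) :=
  \row_s (if (tagnat.sig1 s == g %% m :> nat)%N then
     center_Xm ^+ (g %/ m) * base_inj (coords B z a 0 (tagnat.sig2 s)) else 0).
rewrite (coords_uniq uP (c := c)) ?mxE //.
rewrite (ore_monomial_comb (fun=> zP) (@inj_id _)).
by apply: eq_bigr => s' _; rewrite mxE.
Qed.

(** The image of z_i t^j is a sigma^f(z_i) t^(f+j). It has a component in block [j] only if [m]
    divides [f], in which case sigma^f is the identity. *)
Lemma lmul_ore_monomial a f s :
  lmul_mx R u (oreC sigma a * t ^+ f) s s =
  if (m %| f)%N then center_Xm ^+ (f %/ m) *
    base_inj (lmul_mx B z a (tagnat.sig2 s) (tagnat.sig2 s)) else 0.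
Proof.
rewrite !mxE /ore_family -mulrA (mulrA (t ^+ f)) oreXn_comm -mulrA -exprD mulrA.
rewrite -rmorphM coords_ore_monomial /=; set j := tagnat.sig1 s.
have lt_jm : (j < m)%N := ltn_ord j.
have -> : (j == (f + j) %% m :> nat)%N = (m %| f)%N.
  by rewrite -[in LHS](modn_small lt_jm) modnDmr -[(j %% m)%N]/((0 + j) %% m)%N
    eq_sym eqn_modDr mod0n.
case: ifP => // mf.
by rewrite iter_sigma_dvd // divnDl // (divn_small lt_jm) addn0.
Qed.

Lemma tr_ore_monomial a f : ~~ (m %| f)%N -> trS (oreC sigma a * t ^+ f) = 0.
Proof.
move=> /negPf mNf; rewrite /tr /mxtrace big1 // => s _.
by rewrite lmul_ore_monomial mNf.
Qed.

Lemma tr_oreC a : trS (oreC sigma a) = base_inj (tr B z a) *+ m.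
Proof.
rewrite -[oreC sigma a]mulr1 -(expr0 t) /tr /mxtrace.
under eq_bigr do rewrite lmul_ore_monomial dvdn0 div0n expr0 mul1r.
rewrite (sum_tagnat (fun _ i => base_inj (lmul_mx B z a i i))).
by rewrite sumr_const card_ord rmorph_sum.
Qed.

(** The reduction mod [m] acts only at [j = 0], sending [m] to 0. *)
Definition ord_neg (j : 'I_m) : 'I_m :=
  Ordinal (ltn_pmod (m - j) m_gt0).

Lemma ord_negE (j l : 'I_m) : (m %| j + ord_neg l)%N = (j == l).
Proof.
rewrite /dvdn /= modnDmr -/(dvdn _ _) addnBA ?(ltnW (ltn_ord l)) //.
rewrite -eqn_mod_dvd; last by rewrite (leq_trans (ltnW (ltn_ord l))) ?leq_addl.
by rewrite modnDr !modn_small.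
Qed.

Lemma ord_neg_inj : injective ord_neg.
Proof.
by move=> j l jl; apply/eqP; rewrite -ord_negE -jl ord_negE.
Qed.

(** The exception at [j = 0] is what makes t^m occur in [m - 1] blocks instead of [m]. *)
Lemma addn_ord_neg (j : 'I_m) : (j + ord_neg j = (0 < j) * m)%N.
Proof.
rewrite /=; case: j => [[|j] lt_jm] /=; first by rewrite subn0 modnn.
by rewrite modn_small ?subnKC ?mul1n // ?(ltnW lt_jm) // ltn_subrL m_gt0.
Qed.

(* [v s = t ^ (-j mod m) * z i], so that [u s * v s'] never applies [sigma]
   when the resulting power of [t] is central. *)
Let v := ore_family (fun j i => iter (ord_neg j) sigma (z i)) ord_neg.

Let vP : is_basis R v.
Proof.
apply: ore_family_basis ord_neg_inj => j; exact: iter_sigma_basis.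
Qed.

Lemma gram_ore_family :
  gram_mx trS u v =
  mxdiag (fun j : 'I_m => (center_Xm ^+ (0 < j)%N *+ m) *:
    map_mx base_inj (\matrix_(i, l) tr B z (z i * z l))).
Proof.
apply/matrixP=> s s'; rewrite !mxE /v /ore_family /=.
set j := tagnat.sig1 s; set j' := tagnat.sig1 s'.
rewrite -oreXn_comm mulrA -(mulrA (oreC _ _)) -exprD.
case: eqVneq => [<-|jj']; last first.
  by rewrite mxE -mulrA oreXn_comm mulrA -rmorphM tr_ore_monomial ?ord_negE.
rewrite conform_mx_id addn_ord_neg mulnC exprM.
(* On the diagonal the power of t is 1 or t^m, an element of R, and leaves the trace by
   R-linearity. *)
rewrite -[t ^+ m]/(csub_val center_Xm) -rmorphXn -csub_valC -mulrA -rmorphM.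
by rewrite (trZ uP) tr_oreC !mxE mulrnAr mulrnAl.
Qed.

Lemma det_gram_ore_family :
  \det (gram_mx trS u v) =
  m%:R ^+ (m * n) * base_inj (disc B z) ^+ m * center_Xm ^+ (m.-1 * n).
Proof.
rewrite gram_ore_family det_mxdiag.
under eq_bigr do rewrite detZ det_map_mx -mulr_natr exprMn.
rewrite !big_split /= !prodr_const card_ord -exprM -/(disc B z) (mulnC m n).
rewrite [RHS]mulrAC; congr (_ * _); rewrite mulrC; congr (_ * _).
(* Split off block 0, which carries no factor t^m. *)
rewrite -(prednK m_gt0) big_ord_recl /= expr0 expr1n mul1r mulnC exprM.
by rewrite prodr_const card_ord exprAC.
Qed.

Lemma disc_ore N (w : 'I_N -> ore sigma) :
  [pchar k] =i pred0 -> is_basis R w ->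
  exists c d : csub_of R, c * d = 1 /\
    disc R w = c * (base_inj (disc B z) ^+ m * center_Xm ^+ (m.-1 * n)).
Proof.
move=> chk wP; have NE := basis_size chk uP wP.
case: N / NE w wP => w wP.
have [c [d [cd1 ->]]] := disc_gram wP uP vP.
(* In characteristic zero [m] is invertible in R, so m^(mn) is absorbed into the unit. *)
have m_unit : (m%:R : csub_of R) * (m%:R^-1)%:A = 1.
  rewrite -scaler_nat -scalerAl mul1r scalerA mulfV ?scale1r //.
  by have /pcharf0P -> := chk; rewrite -lt0n.
exists (c * m%:R ^+ (m * n)), (d * (m%:R^-1)%:A ^+ (m * n)); split.
  by rewrite mulrACA cd1 mul1r -exprMn m_unit expr1n.
by rewrite det_gram_ore_family !mulrA.
Qed.

End Trace.
End FreeOreExtension.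

Theorem theorem1 (k : closedFieldType) (A : algType k)
    (sigma : {lrmorphism A -> A}) (m n : nat) (R : centralSubalg (ore sigma)) :
  let S := ore sigma in
  let t : S := oreX sigma in
  let B := fixed_base R in
  [pchar k] =i pred0 ->
  bijective sigma ->
  has_order sigma m ->
  (forall i, (1 <= i < m)%N -> ~ inner (iter i sigma)) ->
  free_of_rank B n ->
  (forall x : S, x \in (R : {pred S}) <-> in_adjoin B (t ^+ m) x) ->
  finite_free R /\
  (forall (z : 'I_n -> A) (N : nat) (w : 'I_N -> S),
    is_basis B z -> is_basis R w ->
    eq_up_to_unit R (csub_val (disc R w))
      (oreC sigma (csub_val (disc B z)) ^+ m * (t ^+ m.-1) ^+ (m * n))).
Proof.
move=> S t B chk sigma_bij [m_gt0 sigmam _] _ [z0 z0P] RE; split.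
  exists (\sum_(j < m) n)%N; exists (ore_family sigma (fun=> z0) id).
  exact: ore_family_basis (fun=> z0P) (@inj_id _).
move=> z N w zP wP.
have [c [d [cd1 ->]]] := disc_ore m_gt0 sigma_bij sigmam RE zP chk wP.
exists c, d; split=> //; rewrite !rmorphM !rmorphXn /=; congr (_ * (_ * _)).
(* Both powers of t have exponent m(m-1)n. *)
by rewrite -!exprM mulnCA mulnA.
Qed.
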